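(* Let $k$ be an algebraically closed field, $r\ge 2$, $R=k[x_0,\ldots,x_r]$. Let $X_1,X_2\subset\mathbb P^r$ be two complete intersection schemes of codimension $2$ of type, respectively, $(d_1,e_1)$ and $(d_2,e_2)$, such that $\min\{d_1,e_1\}>\min\{d_2,e_2\}$, without common components, and assume that $X_1\cup X_2$ is arithmetically Cohen-Macaulay. Let $f_1,g_1,f_2,g_2$, $n$, $p_1,\ldots,p_n$ and $M$ be as described in the context, where $d_i=\deg f_i$, $e_i=\deg g_i$, and let $\pi_i=\deg p_i$. Then the ideal $I_{X_1}\cap I_{X_2}$ admits the following graded free resolution (not necessarily minimal): $$0\to R(-(d_2+e_2))\oplus\bigoplus_{i=1}^nR(-(d_1+e_1+d_2-\pi_i))\stackrel{M}{\longrightarrow} R(-(d_1+d_2))\oplus R(-(e_1+d_2))\oplus\bigoplus_{i=1}^nR(-(e_2+\pi_i))\to I_{X_1}\cap I_{X_2}\to 0.$$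
   Context: $R$ has the standard grading. $I_Y\subset R$ is the saturated homogeneous ideal of $Y\subset\mathbb P^r$; $Y$ is arithmetically Cohen-Macaulay if $R/I_Y$ is Cohen-Macaulay. A complete intersection scheme of codimension $2$ of type $(d,e)$ is one whose ideal is generated by a regular sequence of two forms of degrees $d,e$. An alternating matrix is a skew-symmetric matrix with zero diagonal; $\operatorname{pf}$ denotes the pfaffian; $A_{(i)}$ is $A$ with the $i$-th row and column deleted. Data: $f_1,g_1,f_2,g_2$ are forms with $I_{X_1}=(f_1,g_1)$, $I_{X_2}=(f_2,g_2)$, $g_2$ of minimal degree among the four, and $(f_1,g_1,f_2)$ a regular sequence. The ideal $I_G:=(f_1,g_1,f_2):(f_1,g_1,f_2,g_2)$ is a Gorenstein ideal of codimension $3$; by Buchsbaum-Eisenbud it is minimally generated by $p_1,\ldots,p_n$, $p_i=(-1)^i\operatorname{pf}A_{(i)}$, for an alternating (homogeneous) matrix $A$ of odd size $n$ over $R$. Write $f_1=\sum\alpha_ip_i$, $g_1=\sum\beta_ip_i$, $f_2=\sum\gamma_ip_i$ with $\alpha_i,\beta_i,\gamma_i$ forms. The choices are made so that $g_2=\operatorname{pf}\overline A$, where $$\overline{A}=\begin{pmatrix}0&0&0&\gamma\\ 0&0&0&\beta\\ 0&0&0&\alpha\\ -\gamma^{T}&-\beta^{T}&-\alpha^{T}&A\end{pmatrix},\qquad \alpha=(\alpha_1,\ldots,\alpha_n),\ \beta=(\beta_1,\ldots,\beta_n),\ \gamma=(\gamma_1,\ldots,\gamma_n).$$ Then $M$ is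 the $(n+2)\times(n+1)$ matrix $$M=\begin{pmatrix}0&\beta\\ 0&\alpha\\ \gamma^{T}&A\end{pmatrix}.$$ *)

(* Defs.v *)
From HB Require Import structures.
From mathcomp Require Import all_boot all_order all_algebra.
From mathcomp Require Import mpoly.

Set Implicit Arguments.
Unset Strict Implicit.
Unset Printing Implicit Defensive.

Import GRing.Theory.
Local Open Scope ring_scope.

Section Ideals.
Variable S : comNzRingType.
Implicit Types I J P : S -> Prop.

Definition ideal_axiom I :=
  [/\ I 0, (forall x y, I x -> I y -> I (x + y))
    & (forall a x, I x -> I (a * x))].

Definition ideal_sub I J := forall x, I x -> J x.
Definition ideal_eq I J := forall x, I x <-> J x.

Definition ideal0 : S -> Prop := fun x => x = 0.
Definition idealI I J : S -> Prop := fun x => I x /\ J x.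

(* I : J *)
Definition colon I J : S -> Prop := fun x => forall y, J y -> I (x * y).

(* I + (a) *)
Definition ideal_adjoin I (a : S) : S -> Prop :=
  fun z => exists y c, I y /\ z = y + c * a.

Definition ideal_gen (s : seq S) : S -> Prop :=
  fun x => exists c : 'I_(size s) -> S, x = \sum_(i < size s) c i * s`_i.

Definition minimally_generated n (I : S -> Prop) (p : 'I_n -> S) :=
  ideal_eq I (ideal_gen [seq p i | i : 'I_n]) /\
  (forall i, ~ ideal_gen [seq p j | j in predC1 i] (p i)).

Definition prime_ideal P :=
  [/\ ideal_axiom P, ~ P 1 & forall x y, P (x * y) -> P x \/ P y].

Definition maximal_ideal P :=
  [/\ ideal_axiom P, ~ P 1
    & forall J, ideal_axiom J -> ideal_sub P J -> J 1 \/ ideal_sub J P].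

Definition minimal_prime_over I P :=
  [/\ prime_ideal P, ideal_sub I P
    & forall Q, prime_ideal Q -> ideal_sub I Q -> ideal_sub Q P ->
        ideal_sub P Q].

(* s is a regular sequence on the module S / I; in particular the quotient
   S / (I + (s)) is nonzero. *)
Fixpoint regular_seq_mod I (s : seq S) : Prop :=
  match s with
  | [::] => ~ I 1
  | a :: s' =>
      (forall y, I (a * y) -> I y) /\ regular_seq_mod (ideal_adjoin I a) s'
  end.

Definition regular_seq (s : seq S) := regular_seq_mod ideal0 s.

(* The ideals of the ring S / I are represented by the ideals of S that
   contain I: the next two predicates are depth (P / I) = m and
   codim (P / I) = m in S / I. *)
Definition depth_mod I P (m : nat) :=
  (exists s, [/\ size s = m, (forall a, a \in s -> P a)
               & regular_seq_mod I s]) /\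
  (forall s, (forall a, a \in s -> P a) -> regular_seq_mod I s ->
     (size s <= m)%N).

Definition prime_chain I P (m : nat) (C : nat -> S -> Prop) :=
  [/\ (forall i, (i <= m)%N -> prime_ideal (C i) /\ ideal_sub I (C i)),
      (forall i, (i < m)%N ->
         ideal_sub (C i) (C i.+1) /\ ~ ideal_sub (C i.+1) (C i))
    & ideal_eq (C m) P].

Definition height_mod I P (m : nat) :=
  (exists C, prime_chain I P m C) /\
  (forall m' C, prime_chain I P m' C -> (m' <= m)%N).

(* The (Noetherian) ring S / I is Cohen-Macaulay: depth and codimension agree
   at every maximal ideal. *)
Definition cohen_macaulay_quotient I :=
  forall P, maximal_ideal P -> ideal_sub I P ->
    exists m, depth_mod I P m /\ height_mod I P m.

End Ideals.

Section Pfaffian.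
Variable S : comNzRingType.

Definition alternating n (A : 'M[S]_n) :=
  A^T = - A /\ forall i, A i i = 0.

(* Expansion of the pfaffian along the first row; the submatrix drops the
   rows and columns 0 and j + 1. *)
Fixpoint pf n : 'M[S]_n -> S :=
  match n return 'M[S]_n -> S with
  | 0 => fun=> 1
  | n1.+1 =>
    match n1 return 'M[S]_n1.+1 -> S with
    | 0 => fun=> 0
    | m.+1 => fun A =>
        \sum_(j < m.+1) (-1) ^+ j * A ord0 (lift ord0 j) *
          @pf m (row' j (col' j (row' ord0 (col' ord0 A))))
    end
  end.

(* (-1)^i pf A_(i), where rows are numbered from 1. *)
Definition sub_pf n (A : 'M[S]_n) (i : 'I_n) : S :=
  (-1) ^+ i.+1 * pf (row' i (col' i A)).

Definition bordered_mx n (al be ga : 'rV[S]_n) (A : 'M[S]_n) :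
    'M[S]_(1 + 1 + 1 + n) :=
  let B := col_mx (col_mx ga be) al in block_mx 0 B (- B^T) A.

Definition resolution_mx n (al be ga : 'rV[S]_n) (A : 'M[S]_n) :
    'M[S]_(1 + 1 + n, 1 + n) :=
  col_mx (col_mx (row_mx 0 be) (row_mx 0 al)) (row_mx ga^T A).

End Pfaffian.

Section Projective.
Variables (k : closedFieldType) (r : nat).
Local Notation R := {mpoly k[r.+1]}.

(* Forms of a possibly negative degree z: R_z = 0 for z < 0. *)
Definition is_form (z : int) (p : R) : bool :=
  if z is Posz d then p \is d.-homog else p == 0.

Definition homogeneous_ideal (I : R -> Prop) :=
  forall p d, I p -> I (pihomog mdeg d p).

Definition saturated (I : R -> Prop) :=
  forall p, (exists N, forall m : 'X_{1..r.+1}, mdeg m = N -> I ('X_[m] * p)) ->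
    I p.

(* A closed subscheme of the projective r-space over k, given by its saturated
   homogeneous ideal. *)
Record subscheme := Subscheme {
  scheme_ideal : R -> Prop;
  scheme_idealP : ideal_axiom scheme_ideal;
  scheme_homogeneous : homogeneous_ideal scheme_ideal;
  scheme_saturated : saturated scheme_ideal
}.

Lemma union_idealP (X Y : subscheme) :
  ideal_axiom (idealI (scheme_ideal X) (scheme_ideal Y)).
Proof.
case: (scheme_idealP X) => X0 XD XM; case: (scheme_idealP Y) => Y0 YD YM.
split=> [//|x y [? ?] [? ?]|a x [? ?]]; split; by [apply: XD|apply: YD|apply: XM|apply: YM].
Qed.

Lemma union_homogeneous (X Y : subscheme) :
  homogeneous_ideal (idealI (scheme_ideal X) (scheme_ideal Y)).
Proof. by move=> p d [? ?]; split; apply: scheme_homogeneous. Qed.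

Lemma union_saturated (X Y : subscheme) :
  saturated (idealI (scheme_ideal X) (scheme_ideal Y)).
Proof.
by move=> p [N h]; split; apply: scheme_saturated; exists N => m /h[].
Qed.

Definition scheme_union (X Y : subscheme) : subscheme :=
  Subscheme (union_idealP X Y) (@union_homogeneous X Y) (@union_saturated X Y).

Definition arithmetically_CM (X : subscheme) :=
  cohen_macaulay_quotient (scheme_ideal X).

(* The irreducible components of X correspond to the minimal primes of its
   saturated ideal. *)
Definition no_common_component (X Y : subscheme) :=
  ~ exists P, minimal_prime_over (scheme_ideal X) P /\
              minimal_prime_over (scheme_ideal Y) P.

(* X is a complete intersection of codimension 2 and type (d, e), with
   generators f and g of degrees d and e. *)
Definition complete_intersection2 (X : subscheme) (f g : R) (d e : nat) :=
  [/\ f \is d.-homog, g \is e.-homog, regular_seq [:: f; g]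
    & ideal_eq (scheme_ideal X) (ideal_gen [:: f; g])].

(* M is a degree 0 graded map from the sum of the R(- b_j) to the sum of the
   R(- a_i), acting on column vectors. *)
Definition graded_mx m n (a : 'rV[int]_m) (b : 'rV[int]_n) (M : 'M[R]_(m, n)) :=
  forall i j, is_form (b 0 j - a 0 i) (M i j).

Definition homogeneous_mx m n (M : 'M[R]_(m, n)) :=
  exists a b, graded_mx a b M.

(* 0 -> (+)_j R(- b_j) --M--> (+)_i R(- a_i) --h--> I -> 0 is an exact sequence
   of graded modules and degree 0 maps, for some h. *)
Definition graded_free_resolution1 m n (a : 'rV[int]_m) (b : 'rV[int]_n)
    (M : 'M[R]_(m, n)) (I : R -> Prop) :=
  graded_mx a b M /\
  exists h : 'rV[R]_m,
    [/\ graded_mx (0 : 'rV[int]_1) a h,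
        (forall x, I x <-> exists u : 'cV[R]_m, x = (h *m u) 0 0),
        (forall u : 'cV[R]_m, h *m u = 0 <-> exists v : 'cV[R]_n, u = M *m v)
      & (forall v : 'cV[R]_n, M *m v = 0 -> v = 0)].

End Projective.

(* Main.v *)
(** Write p for the vector of signed sub-pfaffians of A.  Expanding pfaffians of
    bordered matrices gives A p = 0 and, for every row x, a matrix Q with
    (x.p) Id = A Q + x^T p^T: multiplication by f1, g1 or f2 is null-homotopic on
    R -p-> R^n -A-> R^n -p^T-> R.  As f1, g1, f2 is a regular sequence, this complex
    is exact at both copies of R^n.  Expanding the pfaffian W(x, y)_i of A_(i)
    bordered by x and y gives A W(x, y) = (x.p) y^T - (y.p) x^T, while z.W(x, y) is
    the pfaffian of A bordered by z, x, y.  Hence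
    f2 W(be, al) - g1 W(ga, al) + f1 W(ga, be) lies in ker A = R p and pairs with ga
    to f2 g2, so it equals g2 p, and the components of
      q = g2 p - f2 W(be, al) = f1 W(ga, be) - g1 W(ga, al)
    lie in both ideals.  The row (f1 f2, - g1 f2, q^T) is the augmentation map:
    surjectivity holds because the coefficient of g2 in an element of the
    intersection lies in I_G, and a syzygy is reduced, by the regular sequence
    (f2, g2), to one of p.  The degrees of the entries of A are forced: splitting
    A p = 0 into homogeneous parts yields vectors of ker A = R p, so that
    deg A_ij + pi_i + pi_j is constant, and the degree of g2 = pf gives the constant. *)
Require Import Defs.
From HB Require Import structures.
From mathcomp Require Import all_boot all_order all_algebra.
From mathcomp Require Import mpoly zify ring.

Set Implicit Arguments.
Unset Strict Implicit.
Unset Printing Implicit Defensive.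

Import GRing.Theory.
Local Open Scope ring_scope.

(** * Pfaffian expansions *)

(* Pairs the two orders in which the same two positions can be deleted. *)
Lemma sum_lift_pairs (V : nmodType) n (F : nat -> nat -> V) :
  \sum_(j < n.+1) \sum_(k < n) F j k =
  \sum_(j < n.+1) \sum_(k < n | (j <= k)%N) (F j k + F k.+1 j).
Proof.
have E : \sum_(j < n.+1) \sum_(k < n | (k < j)%N) F j k =
         \sum_(j < n.+1) \sum_(k < n | (j <= k)%N) F k.+1 j.
  rewrite big_ord_recl /= big_pred0 // add0r [RHS]big_ord_recr /=.
  rewrite [X in _ = _ + X]big_pred0 => [|k]; last by rewrite leqNgt ltn_ord.
  rewrite addr0; under eq_bigr do rewrite big_mkcond.
  rewrite exchange_big; apply: eq_bigr => k _; rewrite [RHS]big_mkcond.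
  by apply: eq_bigr => j _.
under [RHS]eq_bigr do rewrite big_split.
rewrite big_split /= -E -big_split; apply: eq_bigr => j _ /=.
rewrite (bigID (fun k : 'I_n => (j <= k)%N)) /=; congr (_ + _).
by apply: eq_bigl => k; rewrite -ltnNge.
Qed.

(** * Pfaffians of sequences and lists of symbols: alternation and reordering *)

Section SequencePfaffian.
Variables (S : comNzRingType) (T : Type) (a : T -> T -> S).

(** Letting [g] run over all naturals turns the deletion of rows and columns into composition with
    [bump]; values beyond [m] are never read. *)
Definition seq_pf m (g : nat -> T) : S := pf (\matrix_(i < m, j < m) a (g i) (g j)).

Lemma eq_seq_pf m g g' :
  (forall i, (i < m)%N -> g i = g' i) -> seq_pf m g = seq_pf m g'.
Proof. by move=> e; congr pf; apply/matrixP=> i j; rewrite !mxE !e. Qed.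

Lemma seq_pfS m g :
  seq_pf m.+1 g = \sum_(j < m) (-1) ^+ j * a (g 0) (g j.+1) *
    seq_pf m.-1 (fun i => g (bump j i).+1).
Proof.
case: m => [|m]; first by rewrite big_ord0.
rewrite /seq_pf; set M := \matrix_(i, j) _.
rewrite -[pf M]/(\sum_(j < m.+1) (-1) ^+ j * M ord0 (lift ord0 j) *
          pf (row' j (col' j (row' ord0 (col' ord0 M))))).
apply: eq_bigr => j _; rewrite /M !mxE; congr (_ * _).
by congr pf; apply/matrixP => i l; rewrite !mxE.
Qed.

Definition swap_nat k i := if i == k then k.+1 else if i == k.+1 then k else i.

(** Expansion along two rows, with terms grouped by unordered pairs of columns. The first two
    symbols then enter only through their own entry and through 2 by 2 minors, which shows the
    effect of equating or exchanging them. *)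
Lemma seq_pfSS m g :
  seq_pf m.+2 g = a (g 0) (g 1) * seq_pf m (fun i => g i.+2) -
    \sum_(j < m.-1.+1) \sum_(k < m.-1 | (j <= k)%N) (-1) ^+ (j + k) *
     (a (g 0) (g j.+2) * a (g 1) (g k.+3) - a (g 0) (g k.+3) * a (g 1) (g j.+2))
     * seq_pf m.-2 (fun i => g (bump j (bump k i)).+2).
Proof.
have bumpSS j i : bump j.+1 i.+1 = (bump j i).+1 by rewrite /bump ltnS addnS.
have bump0 i : bump 0 i = i.+1 by [].
rewrite seq_pfS big_ord_recl /= mul1r; congr (_ * _ + _).
case: m => [|m]; first by rewrite big_ord0 big_ord1 big_ord0 oppr0.
pose F j k := (-1) ^+ (j + k) *
  (a (g 0) (g j.+2) * a (g 1) (g (bump j k).+2)) *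
  seq_pf m.-1 (fun i => g (bump j (bump k i)).+2).
transitivity (- \sum_(j < m.+1) \sum_(k < m) F j k).
  rewrite -sumrN; apply: eq_bigr => j _; rewrite seq_pfS mulr_sumr -sumrN.
  apply: eq_bigr => k _; rewrite /F exprD bump0 bumpSS.
  set p1 := seq_pf _ _; set p2 := seq_pf _ _.
  have -> : p1 = p2 by apply: eq_seq_pf => i _; rewrite /= bumpSS.
  have -> : bump j.+1 0 = 0 by [].
  by rewrite exprS; ring.
rewrite sum_lift_pairs; congr (- _); apply: eq_bigr => j _; apply: eq_bigr => k jk.
rewrite /F addSn (addnC k j) exprS.
have -> : bump j k = k.+1 by rewrite /bump jk.
have -> : bump k.+1 j = j by rewrite /bump ltnNge jk.
set p1 := seq_pf _ _; set p2 := seq_pf _ _.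
have -> : p2 = p1.
  apply: eq_seq_pf => i _; congr (g _.+2).
  by rewrite /bump; lia.
by ring.
Qed.

Hypothesis axx : forall x, a x x = 0.
Hypothesis aC : forall x y, a x y = - a y x.

(** Equal symbols in front annihilate the minors of [seq_pfSS]. Further back, the two first-row
    terms that delete one of the copies cancel, and the others keep an adjacent equal pair. The swap
    rule would give this only up to a factor 2. *)
Lemma seq_pf_alt m g k :
  (k.+1 < m)%N -> g k = g k.+1 -> seq_pf m g = 0.
Proof.
move: {2}m (leqnn m) => N; elim: N m g k => [|N IH] [|m] g [|k] //.
- case: m => // m _ _ g01; rewrite seq_pfSS -g01 axx mul0r sub0r big1 ?oppr0 //.
  by move=> j _; rewrite big1 // => i _; ring.
move=> mN km gk; rewrite seq_pfS.
have km1 : (k < m)%N by lia.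
rewrite (bigD1 (Ordinal km1)) // (bigD1 (Ordinal (km : (k.+1 < m)%N))) /=; last first.
  by rewrite -val_eqE /=; lia.
rewrite [X in _ + (_ + X)]big1 => [|j /andP[/eqP jk /eqP jk1]].
  rewrite addr0 gk; set p1 := seq_pf _ _; set p2 := seq_pf _ _.
  have -> : p2 = p1.
    apply: eq_seq_pf => i _; rewrite /bump.
    case: (ltngtP i k) => ik.
    - by congr (g _); lia.
    - by congr (g _); lia.
    by rewrite add0n add1n ik.
  by rewrite exprS; ring.
have {}jk : (j : nat) != k by apply/eqP => e; apply: jk; apply: val_inj.
have {}jk1 : (j : nat) != k.+1 by apply/eqP => e; apply: jk1; apply: val_inj.
have jm := ltn_ord j.
case: (ltnP j k) => jk2.
  rewrite (IH _ _ k.-1) ?mulr0 //; try lia.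
  have -> : bump j k.-1 = k by rewrite /bump; lia.
  by have -> : bump j k.-1.+1 = k.+1 by rewrite /bump; lia.
rewrite (IH _ _ k) ?mulr0 //; try lia.
have -> : bump j k = k by rewrite /bump; lia.
by have -> : bump j k.+1 = k.+1 by rewrite /bump; lia.
Qed.

Lemma seq_pf_swap m g k :
  (k.+1 < m)%N -> seq_pf m (g \o swap_nat k) = - seq_pf m g.
Proof.
move: {2}m (leqnn m) => N; elim: N m g k => [|N IH] [|m] g [|k] //.
- case: m => // m _ _; rewrite !seq_pfSS opprB addrC -sumrN; congr (_ + _).
    by apply: eq_bigr => j _; rewrite -sumrN; apply: eq_bigr => i _ /=; ring.
  by rewrite /= aC mulNr.
move=> mN km; rewrite !seq_pfS -sumrN.
have km1 : (k < m)%N by lia.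
pose o1 := Ordinal km1; pose o2 := Ordinal (km : (k.+1 < m)%N).
have o21 : o2 != o1 by rewrite -val_eqE /=; lia.
rewrite (bigD1 o1) // (bigD1 o2) //= [RHS](bigD1 o1) //= [in RHS](bigD1 o2) //=.
rewrite !addrA; congr (_ + _).
  rewrite addrC; congr (_ + _).
    rewrite /swap_nat /= eqxx gtn_eqF // exprS.
    set p1 := seq_pf _ _; set p2 := seq_pf _ _.
    have -> : p2 = p1; last by ring.
    by apply: eq_seq_pf => i _ /=; congr (g _); rewrite /bump; do ?case: ifP; lia.
  rewrite /swap_nat /= eqxx exprS.
  set p1 := seq_pf _ _; set p2 := seq_pf _ _.
  have -> : p2 = p1; last by ring.
  by apply: eq_seq_pf => i _ /=; congr (g _); rewrite /bump; do ?case: ifP; lia.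
apply: eq_bigr => j /andP[/eqP jk /eqP jk1].
have {}jk : (j : nat) != k by apply/eqP => e; apply: jk; apply: val_inj.
have {}jk1 : (j : nat) != k.+1 by apply/eqP => e; apply: jk1; apply: val_inj.
have jm := ltn_ord j.
rewrite /= -mulrN; congr (_ * _).
  by congr (_ * a _ (g _)); rewrite /swap_nat; do ?case: ifP; lia.
(* Deleting a position before the swapped pair moves the pair down by one. *)
pose k' := if (j < k)%N then k.-1 else k.
rewrite -(IH _ _ k') /k'; [|lia|by case: ifP; lia].
apply: eq_seq_pf => i _ /=; congr (g _); rewrite /swap_nat /bump.
by case: (ltnP j k) => ?; do ?case: ifP; lia.
Qed.

Variable x0 : T.

Definition list_pf s := seq_pf (size s) (nth x0 s).
Definition del j (s : seq T) := take j s ++ drop j.+1 s.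

Lemma size_del j s : (j < size s)%N -> size (del j s) = (size s).-1.
Proof. by move=> js; rewrite size_cat size_take size_drop js; lia. Qed.

Lemma nth_del j s i : (j < size s)%N -> nth x0 (del j s) i = nth x0 s (bump j i).
Proof.
move=> js; rewrite nth_cat size_take js /bump.
case: ltnP => ij; first by rewrite nth_take.
by rewrite nth_drop; congr nth; lia.
Qed.

Lemma list_pf_cons x s : list_pf (x :: s) =
  \sum_(j < size s) (-1) ^+ j * a x (nth x0 s j) * list_pf (del j s).
Proof.
rewrite /list_pf seq_pfS; apply: eq_bigr => j _ /=; rewrite size_del //.
by congr (_ * _); apply: eq_seq_pf => i _; rewrite nth_del.
Qed.

Lemma list_pf_alt s1 x s2 : list_pf (s1 ++ x :: x :: s2) = 0.
Proof.
rewrite /list_pf (@seq_pf_alt _ _ (size s1)) ?size_cat //=; first lia.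
by rewrite !nth_cat ltnn subnn ltnNge leqnSn subSnn.
Qed.

Lemma list_pf_swap s1 x y s2 :
  list_pf (s1 ++ x :: y :: s2) = - list_pf (s1 ++ y :: x :: s2).
Proof.
rewrite /list_pf -(@seq_pf_swap _ _ (size s1)) ?size_cat //=; last lia.
apply: eq_seq_pf => i _ /=; rewrite !nth_cat /swap_nat.
case: (ltngtP i (size s1)) => [lis|gis|->].
- by rewrite ltn_eqF ?lis // ltnW.
- case: eqP => [->|ni]; first by rewrite ltnn subnn subSnn.
  rewrite ltnNge ltnW //=.
  by have -> : (i - size s1 = (i - size s1).-2.+2)%N by lia.
by rewrite ltnNge leqnSn subnn subSnn.
Qed.

Lemma list_pf_move s1 x s2 :
  list_pf (s1 ++ x :: s2) = (-1) ^+ size s1 * list_pf (x :: s1 ++ s2).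
Proof.
elim/last_ind: s1 s2 => [|s1 y IH] s2; first by rewrite mul1r.
rewrite -cats1 -catA list_pf_swap /= IH size_cat addn1 exprS -catA /=.
by rewrite mulN1r mulNr.
Qed.

Lemma list_pf_dup s1 x s2 : list_pf (x :: s1 ++ x :: s2) = 0.
Proof.
by rewrite -cat_cons list_pf_move (list_pf_alt [::]) mulr0.
Qed.

(** With [list_pf_cons_del_nth], this plays the role of the cofactor rule: a row against its own
    cofactors gives the pfaffian, against foreign ones a repeated symbol and hence 0. *)
Lemma list_pf_cons_del k s :
  (k < size s)%N -> list_pf (nth x0 s k :: del k s) = (-1) ^+ k * list_pf s.
Proof.
move=> ks; rewrite -[in RHS](cat_take_drop k s) (drop_nth x0) // list_pf_move.
by rewrite size_take ks mulrA -exprMn mulrNN mulr1 expr1n mul1r.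
Qed.

Lemma list_pf_cons_nth k s : (k < size s)%N -> list_pf (nth x0 s k :: s) = 0.
Proof.
by move=> ks; rewrite -{2}(cat_take_drop k s) (drop_nth x0) // list_pf_dup.
Qed.

Lemma list_pf_cons_del_nth i k s : (i < size s)%N -> (k < size s)%N -> i != k ->
  list_pf (nth x0 s i :: del k s) = 0.
Proof.
move=> si sk ik.
have -> : nth x0 s i = nth x0 (del k s) (unbump k i).
  by rewrite nth_del // unbumpK.
by rewrite list_pf_cons_nth // size_del // /unbump; lia.
Qed.

End SequencePfaffian.

(** * Bordered pfaffians of an alternating matrix and the identities they satisfy *)

Section BorderedPfaffian.
Variables (S : comNzRingType) (n : nat) (A : 'M[S]_n).
Hypothesis A_alt : alternating A.

(* The symbol [inl x] stands for a border row [x], the symbol [inr i] for row [i]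
   of [A]; bordered minors of [A] are pfaffians of lists of symbols. *)
Definition border_entry (u v : 'rV[S]_n + 'I_n) : S :=
  match u, v with
  | inl _, inl _ => 0
  | inl x, inr j => x 0 j
  | inr i, inl x => - x 0 i
  | inr i, inr j => A i j
  end.

Local Notation lpf := (list_pf border_entry (inl 0)).

Definition core_seq : seq ('rV[S]_n + 'I_n) := [seq inr i | i <- enum 'I_n].

Lemma size_core_seq : size core_seq = n.
Proof. by rewrite size_map size_enum_ord. Qed.

Lemma nth_core_seq (i : 'I_n) : nth (inl 0) core_seq i = inr i.
Proof. by rewrite (nth_map i) ?size_enum_ord // nth_ord_enum. Qed.

Lemma size_del_core (i : 'I_n) : size (del i core_seq) = n.-1.
Proof. by rewrite size_del size_core_seq. Qed.

Lemma border_entryxx u : border_entry u u = 0.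
Proof. by case: u => //= i; case: A_alt. Qed.

Lemma border_entryC u v : border_entry u v = - border_entry v u.
Proof.
case: u v => [x|i] [y|j] /=; rewrite ?oppr0 ?opprK //.
by case: A_alt => /matrixP/(_ j i); rewrite !mxE.
Qed.

Let pxx := border_entryxx.
Let pC := border_entryC.

Definition pf_col : 'cV[S]_n := \col_i sub_pf A i.

(** The minus sign appears because [sub_pf] takes its signs with rows numbered from 1, while lists
    count from 0. *)
Lemma sub_pfE i : sub_pf A i = - (-1) ^+ i * lpf (del i core_seq).
Proof.
rewrite /sub_pf exprS mulN1r /list_pf size_del_core; congr (_ * pf _).
apply/matrixP => j k; rewrite !mxE !nth_del ?size_core_seq //.
by rewrite (nth_core_seq (lift i j)) (nth_core_seq (lift i k)).
Qed.

Definition dot (x : 'rV[S]_n) (y : 'cV[S]_n) : S := (x *m y) 0 0.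

Lemma dotE x y : dot x y = \sum_i x 0 i * y i 0.
Proof. by rewrite /dot mxE. Qed.

Lemma lpf_core u : lpf (u :: core_seq) =
  - \sum_i border_entry u (inr i) * pf_col i 0.
Proof.
rewrite list_pf_cons size_core_seq -sumrN; apply: eq_bigr => i _.
by rewrite mxE sub_pfE nth_core_seq; ring.
Qed.

Lemma lpf_border_core x : lpf (inl x :: core_seq) = - dot x pf_col.
Proof. by rewrite lpf_core dotE. Qed.

(** Up to sign, entry [i] of the product is the pfaffian of all rows of [A] with row [i] repeated in
    front. *)
Lemma mul_pf_col : A *m pf_col = 0.
Proof.
apply/matrixP => i j; rewrite ord1 !mxE -[LHS]opprK -(lpf_core (inr i)).
by rewrite -nth_core_seq list_pf_cons_nth ?oppr0 // size_core_seq.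
Qed.

(** The homotopy matrix Q: up to sign, entry (j, k) is the pfaffian of [A] without rows and columns
    j, k, bordered by [x]. The index [i] is the position of j once k is deleted. *)
Definition border_cofactor (x : 'rV[S]_n) : 'M[S]_n :=
  \matrix_(j, k) if unlift k j is Some i
    then - (-1) ^+ (k + i) * lpf (inl x :: del i (del k core_seq)) else 0.

Lemma border_cofactorP x :
  (dot x pf_col)%:M = A *m border_cofactor x + x^T *m pf_col^T.
Proof.
apply/matrixP => i k; rewrite !mxE big_ord1 !mxE sub_pfE.
(* Both sides evaluate this pfaffian: for i = k the missing row is restored, for other i a row is
   repeated; expansion along [inr i] gives the right-hand side. *)
transitivity ((-1) ^+ k * lpf (inr i :: inl x :: del k core_seq)).
  have sE := size_core_seq.
  have [->|ik] := eqVneq i k.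
    have := list_pf_cons_del pC (inl 0) (_ : (k.+1 < size (inl x :: core_seq))%N).
    rewrite /= nth_core_seq sE => ->; last exact: ltn_ord.
    rewrite lpf_border_core exprS mulN1r; have := sqrr_sign S k; move: ((-1) ^+ k) => s s2.
    transitivity (s ^+ 2 * dot x pf_col); first by rewrite s2 mul1r.
    by ring.
  suff -> : lpf (inr i :: inl x :: del k core_seq) = 0 by rewrite mulr0.
  rewrite -(nth_core_seq i).
  apply: (list_pf_cons_del_nth pxx pC (inl 0) (i := i.+1) (k := k.+1)
           (s := inl x :: core_seq)); by rewrite /= ?sE ?ltnS ?ltn_ord.
rewrite list_pf_cons /= big_ord_recl /= /del /= drop0 -/(del k core_seq) mulrDr addrC.
congr (_ + _); first by ring.
rewrite (bigD1_ord k) //= [X in X + _](_ : _ = 0); last first.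
  by rewrite mxE unlift_none mulr0.
rewrite add0r size_del_core mulr_sumr; apply: eq_bigr => j _.
rewrite mxE liftK !add0n nth_del ?size_core_seq // (nth_core_seq (lift k j)).
by rewrite -/(del _ _) !exprS exprD; ring.
Qed.

(** The vector W(x, y); for n = 3 it is minus the cross product of [x] and [y]. *)
Definition cross_pf (x y : 'rV[S]_n) : 'cV[S]_n :=
  \col_i ((-1) ^+ i * lpf (inl x :: inl y :: del i core_seq)).

Definition triple_pf (z x y : 'rV[S]_n) : S :=
  lpf (inl z :: inl x :: inl y :: core_seq).

(** A general symbol [u] serves two purposes: a border row yields [dot_cross], while a row of [A]
    makes the left side vanish by repetition and yields [mul_cross]. *)
Lemma lpf_cross u x y : lpf (u :: inl x :: inl y :: core_seq) =
  - (border_entry u (inl x) * dot y pf_col) + border_entry u (inl y) * dot x pf_col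
  + \sum_i border_entry u (inr i) * cross_pf x y i 0.
Proof.
rewrite list_pf_cons /= !big_ord_recl /= /del /= !drop0 !lpf_border_core.
rewrite size_core_seq addrA; congr (_ + _ + _); try by ring.
apply: eq_bigr => i _; rewrite mxE !add0n nth_core_seq.
by rewrite -/(del _ _) !exprS; ring.
Qed.

Lemma dot_cross z x y : dot z (cross_pf x y) = triple_pf z x y.
Proof. by rewrite /triple_pf lpf_cross /= !mul0r oppr0 !add0r dotE. Qed.

Lemma mul_cross x y :
  A *m cross_pf x y = dot x pf_col *: y^T - dot y pf_col *: x^T.
Proof.
apply/matrixP => i j; rewrite ord1 !mxE.
have := lpf_cross (inr i) x y.
rewrite -{1}nth_core_seq (list_pf_cons_nth pxx pC (inl 0) (k := i.+2)
  (s := inl x :: inl y :: core_seq)) /= ?size_core_seq ?ltnS ?ltn_ord //.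
by move/esym/eqP; rewrite addr_eq0 => /eqP e; rewrite -[LHS]opprK -e /=; ring.
Qed.

Lemma triple_pfxx x y : triple_pf x x y = 0.
Proof. exact: (list_pf_alt pxx _ [::]). Qed.

Lemma pf_bordered al be ga : pf (bordered_mx al be ga A) = triple_pf ga be al.
Proof.
rewrite /triple_pf /list_pf /= size_core_seq /bordered_mx.
set B := col_mx _ _; set s := [:: inl ga, inl be, inl al & core_seq].
have sl (i : 'I_(1 + 1 + 1)) : nth (inl 0) s (lshift n i) = inl (row i B).
  case: (split_ordP i) => {}i ->; [case: (split_ordP i) => {}i -> | ];
  by rewrite ord1 /= /B ?(rowKu, rowKd); congr inl; apply/rowP => ?; rewrite mxE.
have sr (i : 'I_n) : nth (inl 0) s (rshift (1 + 1 + 1) i) = inr i.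
  exact: nth_core_seq.
clearbody B; rewrite /seq_pf; apply: (congr1 (@pf S (1 + 1 + 1 + n))).
apply/matrixP => i j; rewrite [RHS]mxE.
case: (split_ordP i) => {}i ->; case: (split_ordP j) => {}j ->; rewrite ?sl ?sr /=.
- by rewrite block_mxEul mxE.
- by rewrite block_mxEur mxE.
- by rewrite block_mxEdl !mxE.
- by rewrite block_mxEdr.
Qed.

End BorderedPfaffian.

(** * Exactness *)

Section Dot.
Variables (S : comNzRingType) (n : nat).
Implicit Types (x : 'rV[S]_n) (y : 'cV[S]_n).

Lemma dotDr x y y' : dot x (y + y') = dot x y + dot x y'.
Proof. by rewrite /dot mulmxDr mxE. Qed.

Lemma dotNr x y : dot x (- y) = - dot x y.
Proof. by rewrite /dot mulmxN mxE. Qed.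

Lemma dotZr x c y : dot x (c *: y) = c * dot x y.
Proof. by rewrite /dot -scalemxAr mxE. Qed.

Lemma dotDl x x' y : dot (x + x') y = dot x y + dot x' y.
Proof. by rewrite /dot mulmxDl mxE. Qed.

Lemma dotNl x y : dot (- x) y = - dot x y.
Proof. by rewrite /dot mulNmx mxE. Qed.

Lemma dotZl x c y : dot (c *: x) y = c * dot x y.
Proof. by rewrite /dot -scalemxAl mxE. Qed.

Lemma dotC x y : dot x y = dot y^T x^T.
Proof. by rewrite /dot -trmx_mul [RHS]mxE. Qed.

Lemma mulmx_dot x y : x *m y = (dot x y)%:M.
Proof. exact: mx11_scalar. Qed.
End Dot.

(** * Divisibility consequences of a regular sequence *)

Section RegularSequence.
Variable S : idomainType.
Implicit Types f g h : S.

Lemma regular_seq_neq0 f s : regular_seq (f :: s) -> f != 0.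
Proof.
by case=> reg _; apply/eqP => f0; move: (reg 1); rewrite f0 mul0r => /(_ erefl)/eqP;
  rewrite oner_eq0.
Qed.

Lemma regular_seq_second f g s y c :
  regular_seq [:: f, g & s] -> g * y = c * f -> exists d, y = d * f.
Proof.
case=> _ [reg _] e; case: (reg y) => [|_ [d [-> ->]]].
  by exists 0, c; rewrite add0r.
by exists d; rewrite add0r.
Qed.

Lemma regular_seq_third f g h s y c d : regular_seq [:: f, g, h & s] ->
  h * y = c * f + d * g -> exists c' d', y = c' * f + d' * g.
Proof.
case=> _ [_ [reg _]] e; case: (reg y) => [|_ [d' [[_ [c' [-> ->]]] ->]]].
  by exists (c * f), d; split=> //; exists 0, c; rewrite add0r.
by exists c', d'; rewrite add0r.
Qed.

End RegularSequence.

(** * Exactness of the complex of p, and of the resolution built from it *)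

Section Exactness.
Variables (S : idomainType) (n : nat) (A : 'M[S]_n) (al be ga : 'rV[S]_n).
Hypothesis A_alt : alternating A.
Local Notation p := (pf_col A).
Local Notation f1 := (dot al p).
Local Notation g1 := (dot be p).
Local Notation f2 := (dot ga p).
Local Notation g2 := (triple_pf A ga be al).
Local Notation W := (cross_pf A).

Hypothesis reg : regular_seq [:: f1; g1; f2].

Let Ap : A *m p = 0 := mul_pf_col A_alt.

Let f1_neq0 : f1 != 0.
Proof. exact: regular_seq_neq0 reg. Qed.

Let f2_neq0 : f2 != 0.
Proof.
(* If f2 = 0, its regularity modulo (f1, g1) puts 1 into (f1, g1), against the properness of (f1,
   g1, f2). *)
apply/eqP => f20; have [_ [_ [reg3 n1]]] := reg; apply: n1.
exists 1, 0; split; last by rewrite mul0r addr0.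
apply: reg3; rewrite f20 mul0r; exists 0, 0; split; last by rewrite mul0r addr0.
by exists 0, 0; rewrite mul0r addr0.
Qed.

Lemma scaler_mx_inj m (c : S) (u v : 'cV[S]_m) : c != 0 -> c *: u = c *: v -> u = v.
Proof.
move=> c0 /colP e; apply/colP => i; apply: (mulfI c0).
by have := e i; rewrite !mxE.
Qed.

Lemma alt_tr : A^T = - A. Proof. by case: A_alt. Qed.

Lemma trmx_pf_col_mul : p^T *m A = 0.
Proof. by apply: trmx_inj; rewrite trmx_mul trmxK alt_tr mulNmx Ap oppr0 !trmx0. Qed.

(** The homotopy identity multiplied on the left by [y^T], which [A] annihilates by skew-symmetry;
    [coker_homotopy] multiplies it on the right by [u]. *)
Lemma ker_homotopy x y : A *m y = 0 -> dot x p *: y = dot x y *: p.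
Proof.
move=> Ay; apply: trmx_inj; have := congr1 (mulmx y^T) (border_cofactorP A_alt x).
rewrite mul_mx_scalar mulmxDr !mulmxA.
have -> : y^T *m A = 0.
  by rewrite -[A]trmxK alt_tr -trmx_mul mulNmx Ay oppr0 trmx0.
by rewrite mul0mx add0r mulmx_dot -dotC mul_scalar_mx !linearZ.
Qed.

Lemma coker_homotopy x u :
  dot p^T u = 0 -> dot x p *: u = A *m (border_cofactor A x *m u).
Proof.
move=> pu; have := congr1 (mulmx^~ u) (border_cofactorP A_alt x).
rewrite /= mul_scalar_mx mulmxDl -!mulmxA mulmx_dot pu.
by rewrite (_ : 0%:M = 0) ?mulmx0 ?addr0 //; apply/matrixP => i j; rewrite !mxE mul0rn.
Qed.

Lemma scale_pf_col_inj c d : c *: p = d *: p -> c = d.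
Proof. by move/(congr1 (dot al)); rewrite !dotZr; apply: mulIf. Qed.

(** By the homotopies, f1 y = (al.y) p and g1 y = (be.y) p. Comparison gives g1 (al.y) = f1 (be.y),
    so f1 divides al.y and can be cancelled. *)
Lemma ker_alternating y : A *m y = 0 -> exists c, y = c *: p.
Proof.
move=> Ay; have e1 := ker_homotopy al Ay; have e2 := ker_homotopy be Ay.
have e : g1 * dot al y = dot be y * f1.
  apply: scale_pf_col_inj.
  by rewrite -scalerA -e1 [dot be y * _]mulrC -[RHS]scalerA -e2 !scalerA mulrC.
have [c ec] := regular_seq_second reg e.
by exists c; apply: (scaler_mx_inj f1_neq0); rewrite e1 ec scalerA mulrC.
Qed.

(* [f1 u], [g1 u], [f2 u] are images [A v1], [A v2], [A v3]; the three elements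
   [g1 v1 - f1 v2], ... of the kernel are multiples of [p], and the Koszul relation
   between them corrects [v1] by a multiple of [p] into a multiple of [f1]. *)
Lemma ker_pf u : dot p^T u = 0 -> exists v, u = A *m v.
Proof.
move=> pu; pose v x := border_cofactor A x *m u.
have ev x : dot x p *: u = A *m v x by apply: coker_homotopy.
have kv x y : exists c, dot y p *: v x - dot x p *: v y = c *: p.
  apply: ker_alternating; rewrite mulmxBr -!scalemxAr -!ev !scalerA.
  by rewrite mulrC subrr.
have [c12 e12] := kv al be; have [c13 e13] := kv al ga; have [c23 e23] := kv be ga.
have koszul : f2 * c12 = - c23 * f1 + c13 * g1.
  apply: scale_pf_col_inj; rewrite scalerDl (mulrC _ f1) (mulrC _ g1) mulrN -mulNr.
  rewrite -!scalerA -e12 -e13 -e23; apply/colP => i; rewrite !mxE.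
  move: (v al i 0) (v be i 0) (v ga i 0) f1 g1 f2 => *; ring.
have [s [t est]] := regular_seq_third reg koszul.
have e : g1 *: (v al - t *: p) = f1 *: (v be + s *: p).
  move/eqP: e12; rewrite est subr_eq => /eqP e.
  rewrite scalerBr e scalerDl scalerDr !scalerA -addrA.
  rewrite (mulrC g1) (mulrC f1 s) addrC addrA addrAC -addrA.
  by rewrite addrA subrK.
have {e} [w ew] : exists w, v al - t *: p = f1 *: w.
  pose d i := regular_seq_second reg (y := (v al - t *: p) i 0) (c := (v be + s *: p) i 0).
  have h i : exists d, (v al - t *: p) i 0 = d * f1.
    apply: d; have := congr1 (fun z : 'cV_n => z i 0) e.
    by rewrite [LHS]mxE [RHS]mxE => ->; rewrite mulrC.
  have [w hw] := fin_all_exists h.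
  by exists (\col_i w i); apply/colP => i; rewrite hw !mxE mulrC.
exists w; apply: (scaler_mx_inj f1_neq0).
rewrite ev scalemxAr -ew mulmxBr -scalemxAr Ap scaler0 subr0 //.
Qed.

Lemma cross_pf_sum :
  f2 *: W be al - g1 *: W ga al + f1 *: W ga be = g2 *: p.
Proof.
set z := LHS.
have [c ec] : exists c, z = c *: p.
  apply: ker_alternating; suff gen (F1 G1 F2 : S) w1 w2 w3 :
    A *m w1 = G1 *: al^T - F1 *: be^T -> A *m w2 = F2 *: al^T - F1 *: ga^T ->
    A *m w3 = F2 *: be^T - G1 *: ga^T ->
    A *m (F2 *: w1 - G1 *: w2 + F1 *: w3) = 0.
    by apply: gen; apply: mul_cross.
  move=> e1 e2 e3; rewrite mulmxDr mulmxBr -!scalemxAr e1 e2 e3.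
  by apply/colP => i; rewrite !mxE; ring.
(* Pairing with [ga] kills the two W that contain [ga]; the coefficient c is then found by
   cancelling f2. *)
have : dot ga z = f2 * g2.
  suff gen (F1 G1 F2 G2 : S) w1 w2 w3 :
    dot ga w1 = G2 -> dot ga w2 = 0 -> dot ga w3 = 0 ->
    dot ga (F2 *: w1 - G1 *: w2 + F1 *: w3) = F2 * G2.
    by apply: gen; rewrite dot_cross ?(triple_pfxx A_alt ga).
  move=> e1 e2 e3; rewrite dotDr dotDr dotNr !dotZr e1 e2 e3.
  by rewrite !mulr0 subr0 addr0.
by rewrite ec dotZr mulrC => /mulfI -> //; apply: f2_neq0.
Qed.

Definition resolution_gens : 'cV[S]_n := g2 *: p - f2 *: W be al.

Local Notation q := resolution_gens.
Local Notation M := (resolution_mx al be ga A).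

(** The first two rows of M carry [be] and [al], so f1 f2 be - g1 f2 al cancels [q^T *m A] as
    computed in [mul_resolution_gens]. *)
Definition resolution_row : 'rV[S]_(1 + 1 + n) :=
  row_mx (row_mx (f1 * f2)%:M (- (g1 * f2))%:M) q^T.

(** This form puts the entries of q in (f1, g1); the definition puts them in (f2, g2). *)
Lemma resolution_gensE : q = f1 *: W ga be - g1 *: W ga al.
Proof.
rewrite /q -cross_pf_sum; move: (f2 *: _) (g1 *: _) (f1 *: _) => a b c.
by rewrite addrAC [_ - a]addrAC subrr add0r addrC.
Qed.

Lemma dot_resolution_gens : dot ga q = 0.
Proof. by rewrite dotDr dotNr !dotZr dot_cross mulrC subrr. Qed.

Lemma mul_resolution_gens : q^T *m A = f2 *: (g1 *: al - f1 *: be).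
Proof.
apply: trmx_inj; rewrite trmx_mul trmxK alt_tr mulNmx mulmxBr -!scalemxAr Ap scaler0.
by rewrite sub0r opprK mul_cross // [RHS]linearZ /= [(_ - _)^T]linearB /= !linearZ.
Qed.

Lemma resolution_row_mx : resolution_row *m M = 0.
Proof.
rewrite /resolution_row /M !mul_row_col !mul_scalar_mx !scale_row_mx !mul_mx_row.
rewrite !add_row_mx !scaler0 !add0r mul_resolution_gens mulmx_dot -dotC.
rewrite dot_resolution_gens; apply/eqP; rewrite row_mx_eq0; apply/andP; split; apply/eqP.
  by apply/matrixP => i j; rewrite !mxE mul0rn.
by rewrite scalerBr !scalerA scaleNr (mulrC f2 g1) (mulrC f2 f1) addrA subrK subrr.
Qed.

Lemma mul_resolution_mx (v0 : 'M_1) (v : 'cV_n) :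
  M *m col_mx v0 v = col_mx (col_mx (be *m v) (al *m v)) (ga^T *m v0 + A *m v).
Proof. by rewrite /M !mul_col_mx !mul_row_col !mul0mx !add0r. Qed.

Lemma mul_resolution_row (u1 u2 : 'M_1) (u : 'cV_n) :
  resolution_row *m col_mx (col_mx u1 u2) u =
  (f1 * f2 * u1 0 0 - g1 * f2 * u2 0 0 + dot q^T u)%:M.
Proof.
rewrite /resolution_row !mul_row_col !mul_scalar_mx mulmx_dot.
by apply/matrixP => i j; rewrite !ord1 !mxE mulNr.
Qed.

(** Pairing the last block with p removes [A] and leaves f2 v0 = 0. Then w = c p, and al.w = c f1 =
    0 forces c = 0. *)
Lemma resolution_mx_inj (v : 'cV_(1 + n)) : M *m v = 0 -> v = 0.
Proof.
rewrite -[v]vsubmxK; move: (usubmx v) (dsubmx v) => v0 w {v}.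
rewrite mul_resolution_mx => /eqP; rewrite !col_mx_eq0 -!andbA.
case/and3P=> /eqP bw /eqP aw /eqP e.
have v00 : v0 = 0.
  have := congr1 (mulmx p^T) e; rewrite mulmxDr !mulmxA trmx_pf_col_mul.
  rewrite mul0mx addr0 mulmx0 (mulmx_dot p^T) -dotC mul_scalar_mx => /eqP.
  by rewrite scalemx_eq0 (negPf f2_neq0) => /eqP.
move: e; rewrite v00 mulmx0 add0r => /ker_alternating[c ew].
have : dot al w = 0 by rewrite /dot aw mxE.
rewrite ew dotZr; move/eqP; rewrite mulf_eq0 (negPf f1_neq0) orbF => /eqP ->.
by rewrite scale0r col_mx0.
Qed.

Lemma resolution_exact (u : 'cV_(1 + 1 + n)) : regular_seq [:: f2; g2] ->
  resolution_row *m u = 0 <-> exists v, u = M *m v.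
Proof.
move=> reg2; split=> [|[v ->]]; last by rewrite mulmxA resolution_row_mx mul0mx.
rewrite -[u]vsubmxK -[usubmx u]vsubmxK.
move: (usubmx (usubmx u)) (dsubmx (usubmx u)) (dsubmx u) => u1 u2 w {u}.
rewrite mul_resolution_row => /matrixP/(_ 0 0); rewrite mxE [RHS]mxE mulr1n => e.
(* Only g2 (p.w) lacks the factor f2 in the relation, so f2 divides p.w; since ga.p = f2,
   subtracting v0 [ga^T] leaves a syzygy of p. *)
have : g2 * dot p^T w =
    (dot (W be al)^T w - f1 * u1 0 0 + g1 * u2 0 0) * f2.
  move: e; have -> : q^T = g2 *: p^T - f2 *: (W be al)^T by apply/rowP => i; rewrite !mxE.
  rewrite dotDl dotNl !dotZl.
  move=> e; apply/eqP; rewrite -subr_eq0 -e; apply/eqP; ring.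
case/(regular_seq_second reg2) => v0 ev0.
have [v ev] : exists v, w - v0 *: ga^T = A *m v.
  apply: ker_pf; rewrite dotDr dotNr dotZr -dotC ev0 subrr //.
have {}ev : w = v0 *: ga^T + A *m v by rewrite -ev addrC subrK.
have e' : g1 * (u2 0 0 - dot al v) = (u1 0 0 - dot be v) * f1.
  have qA : dot q^T (A *m v) = f2 * (g1 * dot al v - f1 * dot be v).
    rewrite /dot mulmxA mul_resolution_gens -/(dot _ _) dotZl dotDl dotNl.
    by rewrite !dotZl.
  move: e; rewrite ev dotDr dotZr -dotC dot_resolution_gens mulr0 add0r qA => e.
  apply: (mulfI f2_neq0); apply/esym/eqP; rewrite -subr_eq0 -e; apply/eqP; ring.
have [c ec] := regular_seq_second reg e'.
have ec' : u1 0 0 - dot be v = g1 * c.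
  by apply: (mulIf f1_neq0); rewrite -e' ec mulrA.
(* Adding c p does not change A v, and shifts be.v by c g1 and al.v by c f1, exactly the remaining
   discrepancies. *)
exists (col_mx v0%:M (v + c *: p)).
rewrite mul_resolution_mx mul_mx_scalar (mulmxDr A) -(scalemxAr c A) Ap scaler0 addr0 -ev.
rewrite !mulmx_dot !dotDr !dotZr [c * g1]mulrC -ec -ec' !(addrC (dot _ v)) !subrK.
by rewrite -!mx11_scalar.
Qed.

Lemma resolution_image x :
  (forall b c1 c2 c3, b * g2 = c1 * f1 + c2 * g1 + c3 * f2 ->
     exists w : 'cV_n, b = dot p^T w) ->
  ((exists c d, x = c * f1 + d * g1) /\ (exists c d, x = c * f2 + d * g2)) <->
  exists u : 'cV_(1 + 1 + n), x = (resolution_row *m u) 0 0.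
Proof.
have trD c (y z : 'cV[S]_n) d : (c *: y - d *: z)^T = c *: y^T - d *: z^T.
  by apply/rowP => i; rewrite !mxE.
have qE w : dot q^T w = g2 * dot p^T w - f2 * dot (W be al)^T w.
  by rewrite /q trD dotDl dotNl !dotZl.
have qE' w : dot q^T w = f1 * dot (W ga be)^T w - g1 * dot (W ga al)^T w.
  by rewrite resolution_gensE trD dotDl dotNl; congr (_ - _); rewrite dotZl.
move=> colonE; split=> [[[c [d e1]] [a [b e2]]]|[u ->]].
  have [w ew] : exists w, b = dot p^T w.
    by apply: (colonE b c d (- a)); rewrite mulNr -e1 e2 addrC addKr.
  (* Equating the two expressions of q.w eliminates g2; regularity of f2 modulo (f1, g1) then yields
     the coefficients of f1 f2 and g1 f2. *)
  have e3 : f2 * (a + dot (W be al)^T w) =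
    (c - dot (W ga be)^T w) * f1 + (d + dot (W ga al)^T w) * g1.
    have e := qE w; rewrite -ew qE' in e.
    have {}e : b * g2 = f1 * dot (W ga be)^T w - g1 * dot (W ga al)^T w
       + f2 * dot (W be al)^T w by rewrite e subrK mulrC.
    move: e2; rewrite e1 e => e2.
    suff gen (F1 G1 F2 w1 w2 w3 : S) :
      c * F1 + d * G1 = a * F2 + (F1 * w1 - G1 * w2 + F2 * w3) ->
      F2 * (a + w3) = (c - w1) * F1 + (d + w2) * G1 by apply: gen.
    move=> E; apply/eqP; rewrite -subr_eq0; apply/eqP.
    transitivity (a * F2 + (F1 * w1 - G1 * w2 + F2 * w3) - (c * F1 + d * G1)).
      by ring.
    by rewrite E subrr.
  have [c' [d' e4]] := regular_seq_third reg e3.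
  exists (col_mx (col_mx c'%:M (- d')%:M) w).
  have sc (z : S) : (z%:M : 'M_1) 0 0 = z by rewrite mxE mulr1n.
  rewrite mul_resolution_row !sc qE -ew e2.
  transitivity (f2 * (c' * f1 + d' * g1) + (g2 * b - f2 * dot (W be al)^T w)).
    by rewrite -e4; ring.
  by ring.
rewrite -[u]vsubmxK -[usubmx u]vsubmxK.
move: (usubmx (usubmx u)) (dsubmx (usubmx u)) (dsubmx u) => u1 u2 w {u}.
rewrite mul_resolution_row; set z := (X in X%:M).
have -> : (z%:M : 'M_1) 0 0 = z by rewrite mxE mulr1n.
rewrite /z; split.
  exists (f2 * u1 0 0 + dot (W ga be)^T w), (- f2 * u2 0 0 - dot (W ga al)^T w).
  rewrite qE'; suff gen (F1 G1 F2 x1 x2 w1 w2 : S) : F1 * F2 * x1 - G1 * F2 * x2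
    + (F1 * w1 - G1 * w2) = (F2 * x1 + w1) * F1 + (- F2 * x2 - w2) * G1 by apply: gen.
  by ring.
exists (f1 * u1 0 0 - g1 * u2 0 0 - dot (W be al)^T w), (dot p^T w).
rewrite qE; move: (dot (W be al)^T w) (dot p^T w) f1 g1 f2 g2 => *; ring.
Qed.
End Exactness.

(** * Degrees *)

Section Forms.
Variables (k : closedFieldType) (r : nat).
Local Notation R := {mpoly k[r.+1]}.
Implicit Types (x y : R) (z : int).

Lemma is_form0 z : is_form z (0 : R).
Proof. by case: z => d /=; rewrite ?eqxx ?rpred0. Qed.

Lemma is_formD z x y : is_form z x -> is_form z y -> is_form z (x + y).
Proof. by case: z => d /=; [apply: rpredD | move=> /eqP-> /eqP->; rewrite addr0]. Qed.

Lemma is_formN z x : is_form z x -> is_form z (- x).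
Proof. by case: z => d /=; [rewrite rpredN | move=> /eqP->; rewrite oppr0]. Qed.

Lemma is_form_sum z I (s : seq I) (P : pred I) (F : I -> R) :
  (forall i, P i -> is_form z (F i)) -> is_form z (\sum_(i <- s | P i) F i).
Proof.
by move=> h; apply: (big_ind (fun x => is_form z x)) => //;
  [apply: is_form0 | move=> x y; apply: is_formD].
Qed.

Lemma is_formM z z' x y : is_form z x -> is_form z' y -> is_form (z + z') (x * y).
Proof.
case: z => d; last by move=> /eqP -> _; rewrite mul0r is_form0.
case: z' => d'; last by move=> _ /eqP ->; rewrite mulr0 is_form0.
exact: dhomogM.
Qed.

Lemma is_form_sign z i x : is_form z x -> is_form z ((-1) ^+ i * x).
Proof. by rewrite -signr_odd mulr_sign => h; case: ifP => // _; apply: is_formN. Qed.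

Definition form_part z x : R := if z is Posz d then pihomog mdeg d x else 0.

Lemma form_part_sum z I (s : seq I) (P : pred I) (F : I -> R) :
  form_part z (\sum_(i <- s | P i) F i) = \sum_(i <- s | P i) form_part z (F i).
Proof. by case: z => d /=; [rewrite linear_sum | rewrite big1]. Qed.

Lemma form_partE z z' x : is_form z x -> form_part z' x = if z' == z then x else 0.
Proof.
case: z => d; last first.
  by move=> /= /eqP ->; rewrite if_same; case: z' => *; rewrite //= pihomog0.
case: z' => d' //= hx; case: eqP => [[->]|ne]; first exact: pihomog_dE.
by rewrite (pihomog_ne0 _ hx) //; apply/eqP => e; apply: ne; rewrite e.
Qed.

Lemma is_form_inj z z' x : x != 0 -> is_form z x -> is_form z' x -> z = z'.
Proof.
move=> x0 /(form_partE z') e /(form_partE z'); rewrite e eqxx.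
by case: eqP => // _ /esym /eqP; rewrite (negPf x0).
Qed.

(** Keeping only the entries of p with b_j + pi_j = t gives another kernel vector, hence a multiple
    c p. The entry at [i0] survives, so c = 1 and no entry was dropped. *)
Lemma graded_kernel n (A : 'M[R]_n) (a b : 'rV[int]_n) (pi : 'I_n -> int)
    (p : 'cV[R]_n) :
  graded_mx a b A -> (forall i, is_form (pi i) (p i 0)) -> (forall i, p i 0 != 0) ->
  A *m p = 0 -> (forall y : 'cV[R]_n, A *m y = 0 -> exists c, y = c *: p) ->
  exists t, forall j, b 0 j + pi j = t.
Proof.
move=> hA hp p0 Ap ker.
case: (pickP 'I_n) => [i0 _|n0]; last by exists 0 => j; have := n0 j.
exists (b 0 i0 + pi i0) => j; set t := b 0 i0 + _.
pose y : 'cV[R]_n := \col_i if b 0 i + pi i == t then p i 0 else 0.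
have [|c ec] := ker y.
  apply/colP => i; rewrite !mxE.
  (* The part of degree t - a_i of row i of A p = 0 consists of the summands with b_l + pi_l = t. *)
  have /colP/(_ i) := Ap; rewrite !mxE => /(congr1 (form_part (t - a 0 i))).
  rewrite form_part_sum [RHS](form_partE _ (is_form0 0)) if_same => {2}<-.
  apply: eq_bigr => l _; rewrite mxE (form_partE _ (is_formM (hA i l) (hp l))).
  have -> : (t - a 0 i == b 0 l - a 0 i + pi l) = (b 0 l + pi l == t).
    by apply/eqP/eqP; lia.
  by case: ifP => //; rewrite mulr0.
have c1 : c = 1.
  have /colP/(_ i0) := ec; rewrite !mxE eqxx => e.
  by apply: (mulIf (p0 i0)); rewrite mul1r.
have /colP/(_ j) := ec; rewrite c1 scale1r mxE; case: eqP => // _ /esym/eqP.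
by rewrite (negPf (p0 j)).
Qed.

Lemma all_del T (P : pred T) j (s : seq T) : all P s -> all P (del j s).
Proof.
rewrite -{1}(cat_take_drop j s) /del !all_cat => /andP[-> /=].
by rewrite -addn1 addnC -drop_drop; case: (drop j s) => //= x t /andP[_]; rewrite drop0.
Qed.

Lemma sum_del T (V : nmodType) (x0 : T) (F : T -> V) j s : (j < size s)%N ->
  \sum_(x <- s) F x = F (nth x0 s j) + \sum_(x <- del j s) F x.
Proof.
move=> js; rewrite -{1}(cat_take_drop j s) (drop_nth x0) // /del !big_cat big_cons /=.
by rewrite addrCA.
Qed.

(* [u.2] is the weight of the symbol [u.1]; the entry in a row of weight [s] and
   a column of weight [t] has degree [E - s - t]. *)
Definition weighted_entries T (e : T -> T -> R) (E : int) (l : seq (T * int)) :=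
  all2rel (fun u v : T * int => is_form (E - u.2 - v.2) (e u.1 v.1)) l.

Lemma weighted_entries_del T (e : T -> T -> R) E l j :
  weighted_entries e E l -> weighted_entries e E (del j l).
Proof.
by move=> h; apply: all_del; apply: sub_all h => u; apply: all_del.
Qed.

(** Each term is a product over a perfect matching of the symbols: E occurs once per pair and every
    weight once. Odd sizes give 0, so rounding is harmless. *)
Lemma is_form_list_pf T (e : T -> T -> R) (x0 : T) (E : int) (l : seq (T * int)) :
  weighted_entries e E l ->
  is_form ((size l)./2%:Z * E - \sum_(u <- l) u.2) (list_pf e x0 (map fst l)).
Proof.
move: {2}(size l) (leqnn (size l)) => N; elim: N l => [|N IH] [|u l] //= sN h.
- by rewrite big_nil mul0r subr0 /list_pf /seq_pf /= dhomog1.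
- by rewrite big_nil mul0r subr0 /list_pf /seq_pf /= dhomog1.
rewrite list_pf_cons size_map; apply: is_form_sum => j _; rewrite -mulrA.
apply: is_form_sign.
have dm : del j (map fst l) = map fst (del j l) by rewrite /del map_cat map_take map_drop.
rewrite dm (nth_map (x0, 0)) //.
have hj := ltn_ord j.
move: h; rewrite /weighted_entries /= allrel_consl allrel_consr /= -andbA.
case/and3P => _ h0 /andP[_ hl].
have uj : is_form (E - u.2 - (nth (x0, 0) l j).2) (e u.1 (nth (x0, 0) l j).1).
  by apply: (all_nthP (x0, 0) h0).
have sd : size (del j l) = (size l).-1 by rewrite size_del.
have lN : ((size l).-1 <= N)%N by lia.
have := IH _ _ (weighted_entries_del j hl); rewrite sd => /(_ lN) /(is_formM uj).
congr (is_form _ _).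
rewrite big_cons (sum_del (x0, 0) _ hj).
have -> : (uphalf (size l) = (size l).-1./2.+1)%N by lia.
by rewrite -addn1 PoszD; ring.
Qed.

(** * Degrees of the bordered pfaffians *)

Section BorderedDegrees.
Variables (n : nat) (A : 'M[R]_n) (D : int) (pi : 'I_n -> int).
Hypothesis A_deg : forall i j, is_form (D - pi i - pi j) (A i j).

Definition weighted_core : seq (('rV[R]_n + 'I_n) * int) :=
  [seq (inr i, pi i) | i <- enum 'I_n].

(** A row of degree d gets weight D - d, so that its entry in column i has degree D - (D - d) - pi_i
    = d - pi_i. *)
Definition weighted_rows (rows : seq ('rV[R]_n * int)) :
    seq (('rV[R]_n + 'I_n) * int) := [seq (inl v.1, D - v.2) | v <- rows].

Lemma weighted_entries_bordered (rows : seq ('rV[R]_n * int)) :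
  (forall v i, v \in rows -> is_form (v.2 - pi i) (v.1 0 i)) ->
  weighted_entries (border_entry A) D (weighted_rows rows ++ weighted_core).
Proof.
move=> h; rewrite /weighted_entries.
apply/allP => u; rewrite mem_cat => hu; apply/allP => v; rewrite mem_cat => hv.
move: hu hv; case/orP => /mapP[u' hx ->]; case/orP => /mapP[v' hy ->] //=.
- exact: is_form0.
- have := h _ v' hx; congr (is_form _ _); ring.
- have := is_formN (h _ u' hy); congr (is_form _ _); ring.
Qed.

Let pf_deg l := @is_form_list_pf _ (border_entry A) (inl 0) D l.

Lemma map_fst_weighted_core : map fst weighted_core = core_seq R n.
Proof. by rewrite -map_comp. Qed.

Lemma size_weighted_core : size weighted_core = n.
Proof. by rewrite size_map size_enum_ord. Qed.

Lemma sum_weighted_core : \sum_(u <- weighted_core) u.2 = \sum_i pi i.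
Proof. by rewrite big_map big_enum. Qed.

Lemma del_weighted_core (i : 'I_n) :
  [/\ map fst (del i weighted_core) = del i (core_seq R n),
      size (del i weighted_core) = n.-1
    & \sum_(u <- del i weighted_core) u.2 = \sum_j pi j - pi i].
Proof.
split; first by rewrite -map_fst_weighted_core /del map_cat map_take map_drop.
  by rewrite size_del size_weighted_core.
rewrite -sum_weighted_core (sum_del (inl 0, 0) _ (_ : (i < size weighted_core)%N)).
  by rewrite (nth_map i) ?size_enum_ord // nth_ord_enum addrC addrK.
by rewrite size_weighted_core.
Qed.

Lemma is_form_sub_pf i :
  is_form ((n.-1)./2%:Z * D - \sum_j pi j + pi i) (sub_pf A i).
Proof.
have [e1 e2 e3] := del_weighted_core i.
rewrite sub_pfE mulNr; apply: is_formN; apply: is_form_sign.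
have /(weighted_entries_del i)/pf_deg := @weighted_entries_bordered [::] (fun _ _ => ltac:(by [])).
by rewrite /= e1 e2 e3; congr is_form; ring.
Qed.

Lemma is_form_cross_pf (x y : 'rV[R]_n) dx dy i :
  (forall i, is_form (dx - pi i) (x 0 i)) -> (forall i, is_form (dy - pi i) (y 0 i)) ->
  is_form ((n.-1)./2%:Z * D - D + dx + dy - \sum_j pi j + pi i) (cross_pf A x y i 0).
Proof.
move=> hx hy; have [e1 e2 e3] := del_weighted_core i.
rewrite mxE; apply: is_form_sign.
have : weighted_entries (border_entry A) D
    (weighted_rows [:: (x, dx); (y, dy)] ++ weighted_core).
  by apply: weighted_entries_bordered => v j; rewrite !inE => /orP[] /eqP->.
move=> /(weighted_entries_del i.+2)/pf_deg; rewrite /= !big_cons /= -!/(del _ _) e1 e2 e3.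
by congr is_form; rewrite -addn1 PoszD; ring.
Qed.

Lemma is_form_triple_pf (x y z : 'rV[R]_n) dx dy dz :
  (forall i, is_form (dx - pi i) (x 0 i)) -> (forall i, is_form (dy - pi i) (y 0 i)) ->
  (forall i, is_form (dz - pi i) (z 0 i)) ->
  is_form ((n.+3)./2%:Z * D - D *+ 3 + dx + dy + dz - \sum_j pi j) (triple_pf A x y z).
Proof.
move=> hx hy hz.
have : weighted_entries (border_entry A) D
    (weighted_rows [:: (x, dx); (y, dy); (z, dz)] ++ weighted_core).
  apply: weighted_entries_bordered => v j; rewrite !inE.
  by case/or3P => /eqP->.
move=> /pf_deg; rewrite /= !big_cons /= map_fst_weighted_core size_weighted_core.
by rewrite sum_weighted_core; congr is_form; ring.
Qed.
End BorderedDegrees.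
End Forms.

(** * Membership in finitely generated ideals and in the colon ideal *)

Section IdealGen.
Variable S : comNzRingType.

Lemma ideal_gen_cons (a : S) s x :
  ideal_gen (a :: s) x <-> exists c y, ideal_gen s y /\ x = c * a + y.
Proof.
split=> [[c ->]|[c [y [[d ->] ->]]]].
  exists (c ord0), (\sum_(i < size s) c (lift ord0 i) * s`_i).
  by split; [exists (fun i => c (lift ord0 i)) | rewrite big_ord_recl].
exists (fun i => oapp d c (unlift ord0 i)); rewrite big_ord_recl unlift_none.
by congr (_ + _); apply: eq_bigr => i _; rewrite liftK.
Qed.

Lemma ideal_gen_nil (x : S) : ideal_gen [::] x <-> x = 0.
Proof.
split=> [[c ->]|->]; first by rewrite big_ord0.
by exists (fun=> 0); rewrite big_ord0.
Qed.

Lemma ideal_gen2 (a b x : S) :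
  ideal_gen [:: a; b] x <-> exists c d, x = c * a + d * b.
Proof.
split=> [/ideal_gen_cons[c [_ [/ideal_gen_cons[d [_ [/ideal_gen_nil -> ->]]] ->]]]|].
  by exists c, d; rewrite addr0.
case=> c [d ->]; apply/ideal_gen_cons; exists c, (d * b); split=> //.
by apply/ideal_gen_cons; exists d, 0; rewrite addr0; split=> //; apply/ideal_gen_nil.
Qed.

Lemma ideal_gen_image n (p : 'I_n -> S) x :
  ideal_gen [seq p i | i : 'I_n] x -> exists w : 'I_n -> S, x = \sum_i w i * p i.
Proof.
have sz : size [seq p i | i : 'I_n] = n by rewrite size_map size_enum_ord.
case=> c ->; exists (fun i => c (cast_ord (esym sz) i)).
rewrite (reindex (cast_ord (esym sz))) /=; last first.
  by exists (cast_ord sz) => i _; rewrite ?cast_ordK ?cast_ordKV.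
apply: eq_bigr => i _; congr (_ * _).
by rewrite (nth_map i) ?size_enum_ord // nth_ord_enum.
Qed.

Lemma ideal_gen0 (s : seq S) : ideal_gen s 0.
Proof. by exists (fun=> 0); rewrite big1 // => i _; rewrite mul0r. Qed.

Lemma colon_adjoin_gen (a b c g x u v w : S) : x * g = u * a + v * b + w * c ->
  colon (ideal_gen [:: a; b; c]) (ideal_gen [:: a; b; c; g]) x.
Proof.
move=> xg y /ideal_gen_cons[c1 [_ [/ideal_gen_cons[c2 [_ [/ideal_gen2[c3 [c4 ->]] ->]]] ->]]].
apply/ideal_gen_cons; exists (x * c1 + c4 * u).
exists ((x * c2 + c4 * v) * b + (x * c3 + c4 * w) * c); split.
  by apply/ideal_gen2; exists (x * c2 + c4 * v), (x * c3 + c4 * w).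
transitivity (x * (c1 * a + c2 * b + c3 * c) + c4 * (x * g)); first by ring.
by rewrite xg; ring.
Qed.

End IdealGen.

(** * The graded resolution of the intersection of the two ideals *)

Theorem corollary1p6 (k : closedFieldType) (r : nat) (hr : (2 <= r)%N)
    (X1 X2 : subscheme k r) (f1 g1 f2 g2 : {mpoly k[r.+1]})
    (d1 e1 d2 e2 : nat)
    (hX1 : complete_intersection2 X1 f1 g1 d1 e1)
    (hX2 : complete_intersection2 X2 f2 g2 d2 e2)
    (hmin : (minn d2 e2 < minn d1 e1)%N)
    (hcomp : no_common_component X1 X2)
    (hCM : arithmetically_CM (scheme_union X1 X2))
    (hg2 : [/\ (e2 <= d1)%N, (e2 <= e1)%N & (e2 <= d2)%N])
    (hreg : regular_seq [:: f1; g1; f2])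
    (n : nat) (hn : odd n) (A : 'M[{mpoly k[r.+1]}]_n)
    (hAalt : alternating A) (hAhom : homogeneous_mx A)
    (p : 'I_n -> {mpoly k[r.+1]}) (hp : forall i, p i = sub_pf A i)
    (hIG : minimally_generated
             (colon (ideal_gen [:: f1; g1; f2])
                    (ideal_gen [:: f1; g1; f2; g2])) p)
    (pi : 'I_n -> nat) (hpi : forall i, p i \is (pi i).-homog)
    (al be ga : 'rV[{mpoly k[r.+1]}]_n)
    (hal : forall i, is_form (d1%:Z - (pi i)%:Z) (al 0 i))
    (hbe : forall i, is_form (e1%:Z - (pi i)%:Z) (be 0 i))
    (hga : forall i, is_form (d2%:Z - (pi i)%:Z) (ga 0 i))
    (hf1 : f1 = \sum_(i < n) al 0 i * p i)
    (hg1 : g1 = \sum_(i < n) be 0 i * p i)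
    (hf2 : f2 = \sum_(i < n) ga 0 i * p i)
    (hpf : g2 = pf (bordered_mx al be ga A)) :
  graded_free_resolution1
    (row_mx (row_mx (const_mx (d1%:Z + d2%:Z)) (const_mx (e1%:Z + d2%:Z)))
            (\row_(i < n) (e2%:Z + (pi i)%:Z)))
    (row_mx (const_mx (d2%:Z + e2%:Z))
            (\row_(i < n) (d1%:Z + e1%:Z + d2%:Z - (pi i)%:Z)))
    (resolution_mx al be ga A)
    (idealI (scheme_ideal X1) (scheme_ideal X2)).
Proof.
case: hX1 => hf1d hg1d _ I1; case: hX2 => hf2d hg2d reg2 I2.
case: hAhom => a [b hA].
have F1 : f1 = dot al (pf_col A).
  by rewrite hf1 dotE; apply: eq_bigr => i _; rewrite mxE hp.
have G1 : g1 = dot be (pf_col A).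
  by rewrite hg1 dotE; apply: eq_bigr => i _; rewrite mxE hp.
have F2 : f2 = dot ga (pf_col A).
  by rewrite hf2 dotE; apply: eq_bigr => i _; rewrite mxE hp.
have G2 : g2 = triple_pf A ga be al by rewrite hpf pf_bordered.
have p0 i : p i != 0.
  by case: hIG => _ /(_ i) h; apply/eqP => pi0; apply: h; rewrite pi0; apply: ideal_gen0.
have P0 i : pf_col A i 0 != 0 by rewrite mxE -hp.
have Pd i : is_form (pi i)%:Z (pf_col A i 0) by rewrite mxE -hp; apply: hpi.
have g20 : g2 != 0.
  apply/eqP => g20; case: reg2 => _ [reg2 n1]; apply: n1.
  exists 1, 0; rewrite mul0r addr0; split=> //; apply: reg2; rewrite g20 mul0r.
  by exists 0, 0; rewrite mul0r addr0.
have reg := hreg; rewrite F1 G1 F2 in reg; rewrite F2 G2 in reg2.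
have ker := @ker_alternating _ _ _ _ _ _ hAalt reg.
have AP := mul_pf_col hAalt.
have [AT _] := hAalt.
have [t1 ht1] := graded_kernel hA Pd P0 AP ker.
(* The transpose of [A] is - [A] and has the same kernel, so the row degrees are controlled like the
   column degrees. *)
have [t2 ht2] : exists t, forall j, (- a) 0 j + (pi j)%:Z = t.
  apply: (@graded_kernel _ _ _ A^T (- b) (- a) (fun i => (pi i)%:Z) (pf_col A)) => //.
  - by move=> i j; have := hA j i; rewrite !mxE; congr is_form; ring.
  - by rewrite AT mulNmx AP oppr0.
  by move=> y; rewrite AT mulNmx => /eqP; rewrite oppr_eq0 => /eqP/ker.
have [D hD] : exists D, forall i j, is_form (D - (pi i)%:Z - (pi j)%:Z) (A i j).
  exists (t1 + t2) => i j; have := hA i j; congr is_form.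
  by rewrite -(ht1 j) -(ht2 i) !mxE; ring.
pose Sp : int := \sum_i (pi i)%:Z.
have n0 : (0 < n)%N by case: (n) hn.
(* The nonzero form p_i0 has degree pi_i0, and also the degree given by its pfaffian expansion. *)
have eS : (n.-1)./2%:Z * D = Sp.
  pose i0 := Ordinal n0.
  have := is_form_inj (P0 i0) (Pd i0); rewrite [pf_col A i0 0]mxE.
  by move=> /(_ _ (is_form_sub_pf hD i0)); rewrite -/Sp; lia.
(* The same comparison for g2 = pf: (n+3)/2 = (n-1)/2 + 2 leaves d1 + e1 + d2 - D = e2. *)
have eD : D = d1%:Z + e1%:Z + d2%:Z - e2%:Z.
  have := is_form_triple_pf hD hga hbe hal; rewrite -G2 -/Sp.
  move=> /(is_form_inj g20 (hg2d : is_form e2%:Z g2)).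
  have -> : ((n.+3)./2 = (n.-1)./2 + 2)%N by lia.
  by rewrite PoszD mulrDl eS; lia.
split.
  move=> i j; rewrite /resolution_mx.
  case: (split_ordP i) => {}i ->; [case: (split_ordP i) => {}i -> |];
  case: (split_ordP j) => {}j ->;
  rewrite ?(row_mxEl, row_mxEr, col_mxEu, col_mxEd) ?mxE ?ord1.
  - exact: is_form0.
  - by have := hbe j; congr is_form; ring.
  - exact: is_form0.
  - by have := hal j; congr is_form; ring.
  - by have := hga i; congr is_form; ring.
  - by have := hD i j; rewrite eD; congr is_form; ring.
have hf1z : is_form d1%:Z f1 := hf1d; have hg1z : is_form e1%:Z g1 := hg1d.
have hf2z : is_form d2%:Z f2 := hf2d; have hg2z : is_form e2%:Z g2 := hg2d.
exists (resolution_row A al be ga); split.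
- move=> i j; rewrite /resolution_row -F1 -G1 -F2.
  case: (split_ordP j) => {}j ->; [case: (split_ordP j) => {}j -> |];
  rewrite !(row_mxEl, row_mxEr) ord1.
  + by rewrite !mxE ord1 mulr1n subr0; have := is_formM hf1z hf2z.
  + by rewrite !mxE ord1 mulr1n subr0; have := is_formN (is_formM hg1z hf2z).
  have qj : resolution_gens A al be ga j 0 = g2 * pf_col A j 0 - f2 * cross_pf A be al j 0.
    by rewrite G2 F2 !mxE.
  rewrite [X in is_form _ X]mxE qj !mxE subr0; apply: is_formD.
    by apply: is_formM hg2z _; have := Pd j; rewrite mxE.
  (* With D known, W(be, al)_j has degree e2 - d2 + pi_j, so f2 W(be, al)_j matches the degree of g2
     p_j. *)
  apply: is_formN; have := is_formM hf2z (is_form_cross_pf hD j hbe hal).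
  by rewrite eS eD -/Sp [cross_pf _ _ _ _ _]mxE; congr is_form; ring.
- move=> x; have := @resolution_image _ _ _ _ _ _ hAalt reg x.
  rewrite -F1 -G1 -F2 -G2 => im.
  have {}im := im _; rewrite -im.
    split=> [[/I1/ideal_gen2 ? /I2/ideal_gen2 ?]|[? ?]] //.
    by split; [apply/I1/ideal_gen2 | apply/I2/ideal_gen2].
  (* A coefficient c with c g2 in (f1, g1, f2) lies in the colon ideal, which p generates. *)
  move=> c c1 c2 c3 e.
  have : colon (ideal_gen [:: f1; g1; f2]) (ideal_gen [:: f1; g1; f2; g2]) c.
    exact: colon_adjoin_gen e.
  case: hIG => hI _ /hI/ideal_gen_image[w ->].
  exists (\col_i w i); rewrite dotE; apply: eq_bigr => i _.
  by rewrite !mxE hp mulrC.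
- by move=> u; apply: resolution_exact.
- by move=> v; apply: resolution_mx_inj.
Qed.
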